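(* Let $G=(V,E)$ be a simple undirected graph. Suppose that for every vertex $i\in V$ and every neighbor $j\in N(i)$ a weight $p_i^j$ is given with $0\le p_i^j\le 1$ and $\sum_{j\in N(i)}p_i^j=1$ for every $i\in V$. Then \[\mathcal{E}(G)\ \ge\ 2\sum_{(i,j)\in E}\sqrt{p_i^j\,p_j^i}.\]
   Context: $N(i)$ denotes the set of neighbors of $i$. If $\lambda_1,\dots,\lambda_n$ are the eigenvalues of the adjacency matrix $A(G)$, the energy of $G$ is $\mathcal{E}(G)=\sum_{k=1}^n|\lambda_k|$. The sum on the right runs over the edges of $G$, each unordered edge counted once. *)

(* Defs.v *)
From mathcomp Require Import all_boot all_order all_algebra.
From mathcomp Require Import complex.
Set Implicit Arguments.
Unset Strict Implicit.
Unset Printing Implicit Defensive.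
Import Order.TTheory GRing.Theory Num.Theory.
Local Open Scope ring_scope.

Record sgraph (V : finType) := SGraph {
  adj :> rel V;
  adj_sym : symmetric adj;
  adj_irr : irreflexive adj
}.

Definition nbrs (V : finType) (G : sgraph V) (i : V) : {set V} :=
  [set j | G i j].

(* Every unordered edge is represented by exactly one ordered pair, the one
   that is increasing for the enumeration of V. *)
Definition edges (V : finType) (G : sgraph V) : {set V * V} :=
  [set ij : V * V | G ij.1 ij.2 & (enum_rank ij.1 < enum_rank ij.2)%N].

Definition adj_mx (R : nzRingType) (V : finType) (G : sgraph V) : 'M[R]_#|V| :=
  \matrix_(a, b) (G (enum_val a) (enum_val b))%:R.

(* The n complex roots of the characteristic polynomial, repeated according
   to their multiplicity. *)
Definition eigenvalues (R : rcfType) (n : nat) (A : 'M[R]_n) : seq R[i] :=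
  sval (closed_field_poly_normal (char_poly (map_mx (real_complex R) A))).

Lemma eigenvaluesP (R : rcfType) (n : nat) (A : 'M[R]_n) :
  char_poly (map_mx (real_complex R) A) =
  \prod_(z <- eigenvalues A) ('X - z%:P).
Proof.
rewrite /eigenvalues; case: closed_field_poly_normal => s /= {1}->.
by rewrite (monicP (char_poly_monic _)) scale1r.
Qed.

Lemma size_eigenvalues (R : rcfType) (n : nat) (A : 'M[R]_n) :
  size (eigenvalues A) = n.
Proof.
have := size_char_poly (map_mx (real_complex R) A).
by rewrite eigenvaluesP size_prod_XsubC => -[].
Qed.

Definition energy (R : rcfType) (V : finType) (G : sgraph V) : R :=
  \sum_(z <- eigenvalues (adj_mx R G)) ComplexField.Normc.normc z.

(* Main.v *)
(* Let S be the matrix with entries sqrt(p_i^j p_j^i) on the edges and 0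
   elsewhere, so that tr (A S) is the right-hand side. By AM-GM,
   2 x_i x_j sqrt(p_i^j p_j^i) <= p_i^j x_i^2 + p_j^i x_j^2, and summing this
   over adjacent pairs shows that the quadratic form of S is at most |x|^2.
   In an orthonormal eigenbasis u_k of A, tr (A S) = sum_k lambda_k <u_k, S u_k>,
   which is therefore at most sum_k |lambda_k|. *)
Require Import Defs.
From mathcomp Require Import all_boot all_order all_algebra.
From mathcomp Require Import complex ring lra.
Set Implicit Arguments.
Unset Strict Implicit.
Unset Printing Implicit Defensive.
Import Order.TTheory GRing.Theory Num.Theory.
Local Open Scope ring_scope.

(** The scalar matrix ['X%:M] is fixed by conjugation, so the characteristic matrices are conjugate
    over the polynomials and have equal determinants. *)
Lemma char_poly_conj (F : comUnitRingType) (n : nat) (P A : 'M[F]_n) :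
  P \in unitmx -> char_poly (invmx P *m A *m P) = char_poly A.
Proof.
move=> Pu; rewrite /char_poly /char_poly_mx !map_mxM /=.
have PV : map_mx polyC (invmx P) *m map_mx polyC P = 1%:M.
  by rewrite -map_mxM mulVmx // map_mx1.
have {1}-> : 'X%:M = map_mx polyC (invmx P) *m 'X%:M *m map_mx polyC P.
  by rewrite mul_mx_scalar -scalemxAl PV scalemx1.
by rewrite -mulmxBl -mulmxBr !det_mulmx mulrAC -det_mulmx PV det1 mul1r.
Qed.

Lemma normcE (R : rcfType) (z : R[i]) :
  real_complex R (ComplexField.Normc.normc z) = `|z|.
Proof. by []. Qed.

Lemma norm_real_complex (R : rcfType) (a : R) :
  `|real_complex R a| = real_complex R `|a|.
Proof. by rewrite normc_def /= expr0n addr0 sqrtr_sqr. Qed.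

(** Diagonalization takes place over [R[i]], so the eigenvectors are complex. Having [|S i j|] in
    the hypothesis lets it be applied to the real vector of moduli of their coordinates. *)
Lemma sum_mul_le_norm_eigenvalues (R : rcfType) (n : nat) (A S : 'M[R]_n) :
  A \is symmetricmx ->
  (forall x : 'I_n -> R,
     \sum_i \sum_j x i * x j * `|S i j| <= \sum_i x i ^+ 2) ->
  \sum_i \sum_j A i j * S i j <=
  \sum_(z <- eigenvalues A) ComplexField.Normc.normc z.
Proof.
move=> Asym hS; pose B := map_mx (real_complex R) A.
have Bn : B \is normalmx.
  apply: symmetric_normalmx.
    apply/is_hermitianmxP; rewrite expr0 scale1r.
    have := is_hermitianmxP _ _ _ Asym; rewrite expr0 scale1r => AT.
    by rewrite /B {1}AT; apply/matrixP => i j; rewrite !mxE.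
  by apply/mxOverP => i j; rewrite mxE complex_real.
have /orthomx_spectralP := Bn.
set P := spectralmx B; set d := spectral_diag B => BE.
have Pu : P \is unitarymx by exact: spectral_unitarymx.
(* Both lists are the roots of the same split polynomial, hence agree up to order. *)
have perm_d : perm_eq (eigenvalues A) [seq d 0 k | k <- enum 'I_n].
  apply: prod_XsubC_eq; rewrite -eigenvaluesP -/B BE.
  rewrite char_poly_conj ?unitarymx_unit // char_poly_trig ?diag_mx_is_trig //.
  rewrite big_map big_enum; apply: eq_bigr => k _.
  by rewrite mxE eqxx mulr1n.
rewrite (perm_big _ perm_d) big_map big_enum /=.
apply: le_trans (ler_norm _) _; rewrite -lecR -[leLHS]norm_real_complex.
(* [q k] is the sesquilinear form of [S] at row [k] of [P]. Expanding [B] as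
   [invmx P *m diag_mx d *m P] gives the sum of the [d 0 k * q k], and it remains to show
   [|q k| <= 1]. *)
pose q k := \sum_i \sum_j (P k i)^* * P k j * real_complex R (S i j).
have -> : real_complex R (\sum_i \sum_j A i j * S i j) = \sum_k d 0 k * q k.
  rewrite rmorph_sum /=.
  under [RHS]eq_bigr do rewrite mulr_sumr.
  rewrite [RHS]exchange_big; apply: eq_bigr => i _ /=.
  rewrite rmorph_sum /=.
  under [RHS]eq_bigr do rewrite mulr_sumr.
  rewrite [RHS]exchange_big; apply: eq_bigr => j _ /=.
  have /matrixP/(_ i j) := BE; rewrite invmx_unitary // mul_mx_diag !mxE.
  rewrite rmorphM /= => ->; rewrite mulr_suml; apply: eq_bigr => k _.
  by rewrite !mxE; ring.
apply: le_trans (ler_norm_sum _ _ _) _; rewrite rmorph_sum /=.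
apply: ler_sum => k _; rewrite normrM normcE ler_piMr //.
pose x i := ComplexField.Normc.normc (P k i).
apply: (@le_trans _ _ (real_complex R (\sum_i \sum_j x i * x j * `|S i j|))).
  apply: le_trans (ler_norm_sum _ _ _) _; rewrite rmorph_sum /=.
  apply: ler_sum => i _.
  apply: le_trans (ler_norm_sum _ _ _) _; rewrite rmorph_sum /=.
  apply: ler_sum => j _.
  by rewrite !rmorphM /= !normcE !normrM norm_conjC norm_real_complex.
apply: (@le_trans _ _ (real_complex R (\sum_i x i ^+ 2))).
  by rewrite lecR hS.
(* The bound 1 is the squared norm of row [k] of the unitary matrix [P]. *)
have /unitarymxP/matrixP/(_ k k) := Pu; rewrite !mxE eqxx mulr1n => <-.
rewrite rmorph_sum /=; apply: ler_sum => i _.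
by rewrite !mxE rmorphXn /= normcE normCK.
Qed.

Lemma weighted_form_le (R : rcfType) (V : finType) (G : sgraph V)
    (p : V -> V -> R) (x : V -> R) :
  (forall i j, G i j -> 0 <= p i j) ->
  (forall i, \sum_(j | G i j) p i j = 1) ->
  \sum_i \sum_(j | G i j) x i * x j * Num.sqrt (p i j * p j i) <=
  \sum_i x i ^+ 2.
Proof.
move=> p0 p1.
have T1 : \sum_i \sum_(j | G i j) p i j * x i ^+ 2 = \sum_i x i ^+ 2.
  by apply: eq_bigr => i _; rewrite -mulr_suml p1 mul1r.
(* Exchanging the sums and using the symmetry of adjacency turns this into [T1]. *)
have T2 : \sum_i \sum_(j | G i j) p j i * x j ^+ 2 = \sum_i x i ^+ 2.
  rewrite -T1 (exchange_big_dep xpredT) //=; apply: eq_bigr => j _.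
  by apply: eq_bigl => i; rewrite adj_sym.
have T : 2 * \sum_i x i ^+ 2 =
    \sum_i \sum_(j | G i j) p i j * x i ^+ 2 +
    \sum_i \sum_(j | G i j) p j i * x j ^+ 2 by rewrite T1 T2 mulr_natl mulr2n.
rewrite -(ler_pM2l (ltr0Sn R 1)) T -big_split mulr_sumr; apply: ler_sum => i _ /=.
rewrite -big_split mulr_sumr; apply: ler_sum => j Gij /=.
have pij := p0 _ _ Gij; have pji : 0 <= p j i by rewrite p0 // adj_sym.
rewrite sqrtrM // -{2}(sqr_sqrtr pij) -{2}(sqr_sqrtr pji).
set a := Num.sqrt _; set b := Num.sqrt _.
(* AM-GM, with [a] and [b] the square roots of [p i j] and [p j i]. *)
have := sqr_ge0 (a * x i - b * x j); nra.
Qed.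

Lemma sum_edges (R : nzRingType) (V : finType) (G : sgraph V) (f : V -> V -> R) :
  (forall i j, f i j = f j i) ->
  \sum_i \sum_(j | G i j) f i j = 2 * \sum_(ij in edges G) f ij.1 ij.2.
Proof.
move=> fC; rewrite pair_big_dep /=.
rewrite (bigID (fun ij : V * V => enum_rank ij.1 < enum_rank ij.2)%N) /=.
rewrite mulr2n mulrDl mul1r; congr (_ + _).
  by apply: eq_bigl => ij; rewrite inE.
(* Swapping coordinates sends the remaining ordered pairs onto [edges G]; equal ranks would mean a
   loop. *)
rewrite (reindex_inj (h := fun ij : V * V => (ij.2, ij.1))) /=; last first.
  by move=> [i j] [k l] [-> ->].
apply: eq_big => [[i j]|[i j] _] /=; last exact: fC.
rewrite inE /= adj_sym -leqNgt leq_eqVlt.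
case: (altP (i =P j)) => [->|ij]; first by rewrite adj_irr.
by rewrite val_eqE (inj_eq enum_rank_inj) (negPf ij).
Qed.

Theorem theorem2p3 (R : rcfType) (V : finType) (G : sgraph V)
    (p : V -> V -> R)
    (hp : forall i j : V, j \in nbrs G i -> 0 <= p i j <= 1)
    (hsum : forall i : V, \sum_(j in nbrs G i) p i j = 1) :
  energy R G >= 2 * \sum_(ij in edges G) Num.sqrt (p ij.1 ij.2 * p ij.2 ij.1).
Proof.
have p0 i j : G i j -> 0 <= p i j.
  by move=> Gij; have /andP[] : 0 <= p i j <= 1 by rewrite hp ?inE.
have p1 i : \sum_(j | G i j) p i j = 1.
  by rewrite -[RHS](hsum i); apply: eq_bigl => j; rewrite inE.
pose f i j := Num.sqrt (p i j * p j i).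
rewrite -(sum_edges G (f := f)); last by move=> i j; rewrite /f mulrC.
(* The adjacency factor makes [S] vanish off the edges, where [p] is arbitrary. *)
pose S : 'M[R]_#|V| :=
  \matrix_(a, b) ((G (enum_val a) (enum_val b))%:R *
                  f (enum_val a) (enum_val b)).
have sumV (F : V -> V -> R) :
    \sum_i \sum_(j | G i j) F i j =
    \sum_(a < #|V|) \sum_(b < #|V|)
      (G (enum_val a) (enum_val b))%:R * F (enum_val a) (enum_val b).
  rewrite (reindex_onto enum_val enum_rank) /=; last first.
    by move=> *; rewrite enum_rankK.
  apply: eq_big => [a|a _]; first by rewrite enum_valK eqxx.
  rewrite (reindex_onto enum_val enum_rank) /=; last first.
    by move=> *; rewrite enum_rankK.
  rewrite [LHS]big_mkcond; apply: eq_bigr => b _.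
  by rewrite enum_valK eqxx andbT; case: ifP; rewrite ?mul1r ?mul0r.
rewrite sumV.
(* Entries of the adjacency matrix are 0 or 1, so multiplying [S] by them entrywise changes
   nothing. *)
apply: (@le_trans _ _ (\sum_a \sum_b adj_mx R G a b * S a b)).
  apply: ler_sum => a _; apply: ler_sum => b _; rewrite !mxE mulrA -natrM.
  by case: (G _ _).
apply: sum_mul_le_norm_eigenvalues => [|x].
  apply/is_hermitianmxP; rewrite expr0 scale1r.
  by apply/matrixP => a b; rewrite !mxE adj_sym.
have := weighted_form_le (fun i => x (enum_rank i)) p0 p1; rewrite sumV.
rewrite [leRHS](reindex_onto enum_val enum_rank) /=; last first.
  by move=> *; rewrite enum_rankK.
under [leRHS]eq_bigr do rewrite enum_valK.
under [leRHS]eq_bigl do rewrite enum_valK eqxx.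
apply: le_trans; apply: ler_sum => a _ /=; apply: ler_sum => b _.
rewrite !enum_valK mxE normrM normr_nat ger0_norm ?sqrtr_ge0 //.
by rewrite mulrCA.
Qed.
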